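(* For every integer $n\geq 1$, $$W_{\tau}(Q_{n})=\frac{(n+1)(n+2)}{2},$$ where $Q_n$ is the $n$-dimensional hypercube.
   Context: All graphs are finite, undirected, without loops or multiple edges. The hypercube $Q_n$ has vertex set $\{0,1\}^n$, with two vertices adjacent if and only if they differ in exactly one coordinate. A total coloring of a graph $G$ is a coloring of its vertices and edges such that no two adjacent vertices, no two adjacent edges, and no vertex and edge incident to each other get the same color. For a total coloring $\alpha$ and a vertex $v$, $S[v,\alpha]$ denotes the set consisting of $\alpha(v)$ and the colors of all edges incident to $v$. For a positive integer $t$, an interval total $t$-coloring of $G$ is a total coloring $\alpha$ of $G$ with colors $1,\ldots,t$ such that all $t$ colors are used (each on at least one vertex or edge), and for every vertex $v$ the set $S[v,\alpha]$ is an interval of integers (a set of consecutive integers). $G$ is interval total colorable if it has an interval total $t$-coloring for some positive integer $t$. For an interval total colorable graph $G$, $W_{\tau}(G)$ denotes the greatest value of $t$ for which $G$ has an interval total $t$-coloring. (Every hypercube $Q_n$, $n\geq 1$, is interval total colorable, so $W_{\tau}(Q_n)$ is defined.) *)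

(* Defs.v *)
From mathcomp Require Import all_boot.

Set Implicit Arguments.
Unset Strict Implicit.
Unset Printing Implicit Defensive.

Record sgraph := SGraph {
  vertex :> finType;
  adj : rel vertex;
  adj_sym : symmetric adj;
  adj_irrefl : irreflexive adj
}.

Arguments adj {s}.

Definition edges (G : sgraph) : {set {set G}} :=
  [set [set x; y] | x in G, y in G & adj x y].

(* [ecol] is defined on all sets of vertices for convenience; every notion     *)
(* below reads its values only on the members of [edges G].                    *)
Record coloring (G : sgraph) := Coloring {
  vcol : G -> nat;
  ecol : {set G} -> nat
}.

Definition total_coloring (G : sgraph) (a : coloring G) : Prop :=
  [/\ forall u v : G, adj u v -> vcol a u <> vcol a v,
      forall e f : {set G}, e \in edges G -> f \in edges G ->
        e != f -> e :&: f != set0 -> ecol a e <> ecol a f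
    & forall (v : G) (e : {set G}), e \in edges G -> v \in e ->
        vcol a v <> ecol a e].

(* The set S[v, a], as a sequence considered up to membership. *)
Definition spectrum (G : sgraph) (a : coloring G) (v : G) : seq nat :=
  vcol a v :: [seq ecol a e | e in [set e in edges G | v \in e]].

Definition interval (s : seq nat) : Prop :=
  exists p q : nat, forall c : nat, (c \in s) = (p <= c <= q).

Definition interval_total_coloring (G : sgraph) (t : nat) (a : coloring G) :
    Prop :=
  [/\ total_coloring a,
      (forall v : G, 1 <= vcol a v <= t) /\
      (forall e : {set G}, e \in edges G -> 1 <= ecol a e <= t),
      forall c : nat, 1 <= c <= t ->
        (exists v : G, vcol a v = c) \/
        (exists2 e : {set G}, e \in edges G & ecol a e = c)
    & forall v : G, interval (spectrum a v)].

Definition has_interval_total_coloring (G : sgraph) (t : nat) : Prop :=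
  0 < t /\ exists a : coloring G, interval_total_coloring t a.

(* W_tau(G) = t. Besides maximality this asserts that W_tau(G) is defined,     *)
(* i.e. that G is interval total colorable.                                    *)
Definition is_Wtau (G : sgraph) (t : nat) : Prop :=
  has_interval_total_coloring G t /\
  forall t' : nat, has_interval_total_coloring G t' -> t' <= t.

Section Hypercube.
Variable n : nat.

Definition cube_adj : rel {ffun 'I_n -> bool} :=
  fun x y => #|[set i | x i != y i]| == 1.

Lemma cube_adj_sym : symmetric cube_adj.
Proof.
move=> x y; rewrite /cube_adj; congr (_ == 1).
by apply: eq_card => i; rewrite !inE eq_sym.
Qed.

Lemma cube_adj_irrefl : irreflexive cube_adj.
Proof.
move=> x; rewrite /cube_adj (_ : [set i | _] = set0) ?cards0 //.
by apply/setP=> i; rewrite !inE eqxx.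
Qed.

Definition hypercube : sgraph := SGraph cube_adj_sym cube_adj_irrefl.

End Hypercube.

(* Main.v *)
(** Upper bound: the spectrum of a vertex [x] is an interval of at most [n + 1]
    colors; let [p x] be its least element.  If [x] and [y] are at distance
    [k > 0], the [k] edges at [x] leading towards [y] have distinct colors, so
    one of them has color at most [p x + n + 1 - k]; its other end [x'] then
    satisfies [p x' <= p x + n + 1 - k].  Summing over [k = n, ..., 1], two
    spectra have least elements differing by at most [n (n + 1) / 2].

    Lower bound: double [Q_n] repeatedly.  The new copy is the old one with
    colors shifted by [n + 2], and the new edge at [v] gets the color following
    the spectrum of [v].  Unfolding this recursion, the spectrum of [x] starts
    at [low x = 1 + \sum_(x_j = 1) (j + 1)]; there the edges in the directions
    [j] with [x_j = 1] come first, in decreasing order of [j], then [x] itself,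
    then the edges with [x_j = 0], in increasing order of [j] (directions are
    numbered from 0). *)
Require Import Defs.
From mathcomp Require Import all_boot zify.

Set Implicit Arguments.
Unset Strict Implicit.
Unset Printing Implicit Defensive.

Lemma triangular_sum n : \sum_(i < n) i.+1 = 'C(n.+1, 2).
Proof.
elim: n => [|n IHn]; first by rewrite big_ord0.
by rewrite big_ord_recr /= IHn [RHS]binS bin1.
Qed.

Lemma bounded_injection_onto (T : finType) (f : T -> nat) m :
  injective f -> #|T| = m -> (forall x, f x < m) ->
  forall k, k < m -> exists x, f x = k.
Proof.
move=> f_inj cardT f_lt k k_lt.
pose g x := Ordinal (f_lt x).
have g_inj : injective g by move=> x y /(congr1 val) /f_inj.
have := inj_card_onto g_inj; rewrite card_ord cardT => /(_ (leqnn _) (Ordinal k_lt)).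
by case/codomP=> x /(congr1 val) /= ->; exists x.
Qed.

(** * Vertices, edges and spectra of the cube in terms of coordinate flips *)

Section Cube.
Variable n : nat.
Implicit Types (x y v w : hypercube n) (i j : 'I_n) (e f : {set hypercube n}).

Definition flip x i : hypercube n := [ffun j => x j (+) (j == i)].

Definition cedge x i : {set hypercube n} := [set x; flip x i].

Lemma flipK i : involutive (flip ^~ i).
Proof. by move=> x; apply/ffunP=> j; rewrite !ffunE -addbA addbb addbF. Qed.

Lemma flip_inj x : injective (flip x).
Proof.
by move=> i j /ffunP/(_ i); rewrite !ffunE eqxx => /addbI/esym/eqP.
Qed.

Lemma flip_neq x i : flip x i != x.
Proof. by apply/eqP=> /ffunP/(_ i); rewrite ffunE eqxx; case: (x i). Qed.

Lemma adj_flip x i : adj x (flip x i).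
Proof.
apply/cards1P; exists i; apply/setP=> j; rewrite !inE ffunE.
by case: (x j); case: (j == i).
Qed.

Lemma adjP x y : reflect (exists i, y = flip x i) (adj x y).
Proof.
apply: (iffP idP) => [/cards1P[i /setP E] | [i ->]]; last exact: adj_flip.
exists i; apply/ffunP=> j; move: (E j); rewrite !inE ffunE => <-.
by case: (x j); case: (y j).
Qed.

Lemma cedge_flip x i : cedge (flip x i) i = cedge x i.
Proof. by rewrite /cedge flipK setUC. Qed.

Lemma cedge_inj x : injective (cedge x).
Proof.
move=> i j /setP/(_ (flip x i)); rewrite !inE eqxx orbT (negPf (flip_neq x i)).
by move/esym/eqP/flip_inj.
Qed.

Lemma mem_cedge x i : x \in cedge x i.
Proof. by rewrite !inE eqxx. Qed.

Lemma cedge_edge x i : cedge x i \in edges (hypercube n).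
Proof. by apply/imset2P; exists x (flip x i); rewrite ?inE ?adj_flip. Qed.

Lemma edgesP e : e \in edges (hypercube n) -> exists x i, e = cedge x i.
Proof. by case/imset2P=> x y _; rewrite !inE => /adjP[i ->] ->; exists x, i. Qed.

Lemma edge_atP e x :
  e \in edges (hypercube n) -> x \in e -> exists i, e = cedge x i.
Proof.
case/edgesP=> v [i ->]; rewrite !inE => /orP[]/eqP->; exists i => //.
by rewrite cedge_flip.
Qed.

Lemma cedge_eq x i y j : cedge x i = cedge y j -> i = j /\ (y = x \/ y = flip x i).
Proof.
move=> E; have := mem_cedge y j; rewrite -E !inE => /orP[]/eqP Ey.
  by split; [move: E; rewrite Ey => /cedge_inj | left].
by split; [move: E; rewrite Ey -cedge_flip => /cedge_inj | right].
Qed.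

Lemma spectrumP (a : coloring (hypercube n)) x c :
  reflect (c = vcol a x \/ exists i, c = ecol a (cedge x i)) (c \in spectrum a x).
Proof.
rewrite inE; apply: (iffP orP) => [[/eqP|/imageP[e]] | [->|[i ->]]]; first by left.
- by rewrite inE => /andP[/edge_atP eP /eP[i ->]] ->; right; exists i.
- by left.
- right; apply/imageP; exists (cedge x i) => //.
  by rewrite inE cedge_edge mem_cedge.
Qed.

Lemma size_spectrum (a : coloring (hypercube n)) x : size (spectrum a x) <= n.+1.
Proof.
rewrite /= size_image ltnS -[leqRHS]card_ord.
apply: leq_trans (leq_imset_card (cedge x) _); apply/subset_leq_card/subsetP=> e.
by rewrite inE => /andP[/edge_atP eP /eP[i ->]]; apply/imsetP; exists i.
Qed.

(** * Spread of the colors in an arbitrary interval total coloring *)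

Section UpperBound.
Variables (t : nat) (a : coloring (hypercube n)).
Hypothesis a_int : interval_total_coloring t a.

Lemma spectrum_bounds x : exists2 p, p \in spectrum a x &
  forall c, c \in spectrum a x -> p <= c <= p + n.
Proof.
have [_ _ _ /(_ x)[p [q pq]]] := a_int.
have le_pq : p <= q.
  by have := pq (vcol a x); rewrite inE eqxx => /esym/andP[/leq_trans]; apply.
exists p => [|c]; first by rewrite pq leqnn.
rewrite pq => /andP[-> /leq_trans]; apply.
(* The colors from [p] to [q] are distinct members of a spectrum of size at most [n + 1], so
   [q - p <= n]. *)
have : size (iota p (q - p).+1) <= n.+1.
  apply: leq_trans (size_spectrum a x); apply: uniq_leq_size (iota_uniq _ _) _.
  by move=> c'; rewrite pq mem_iota; lia.
by rewrite size_iota; lia.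
Qed.

(** Pigeonhole: otherwise the [k + 1] edges at [x] in the directions of [D] would have distinct
    colors among the [k] values from [p + n - k + 1] to [p + n]. *)
Lemma low_edge x (D : {set 'I_n}) p k : #|D| = k.+1 ->
    (forall c, c \in spectrum a x -> p <= c <= p + n) ->
  exists2 i, i \in D & ecol a (cedge x i) <= p + (n - k).
Proof.
move=> cardD bnd; apply/exists_inP; case: exists_inP => // noD.
have k_lt : k < n by rewrite -cardD -[leqRHS]card_ord max_card.
have : size [seq ecol a (cedge x i) | i in D] <= size (iota (p + (n - k)).+1 k).
  apply: uniq_leq_size.
    rewrite map_inj_in_uniq ?enum_uniq // => i j _ _ Eij; apply/eqP.
    apply: contra_eqT Eij => ij; have [[_ eP _] _ _ _] := a_int.
    apply/eqP/eP; rewrite ?cedge_edge ?(inj_eq (@cedge_inj x)) //.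
    by apply/set0Pn; exists x; rewrite inE !mem_cedge.
  move=> _ /imageP[i Di ->].
  have lt_i : p + (n - k) < ecol a (cedge x i).
    by rewrite ltnNge; apply/negP=> le_i; apply: noD; exists i.
  have : ecol a (cedge x i) \in spectrum a x by apply/spectrumP; right; exists i.
  by move/bnd; rewrite mem_iota; lia.
by rewrite size_image size_iota cardD ltnn.
Qed.

(** Induction on the distance: the flip provided by [low_edge] brings [x] one step closer to [y];
    made at distance [j + 1], it raises the lower end of the spectrum by at most [n - j]. *)
Lemma spectrum_growth k x y p c : #|[set i | x i != y i]| = k ->
    (forall d, d \in spectrum a x -> p <= d <= p + n) -> c \in spectrum a y ->
  c <= p + n + \sum_(j < k) (n - j).
Proof.
elim: k x p => [|k IHk] x p dist_xy bnd cy.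
  rewrite big_ord0 addn0.
  have Exy : x = y.
    apply/ffunP=> i; apply/eqP; move/eqP: dist_xy; rewrite cards_eq0.
    by move/eqP/setP/(_ i); rewrite !inE => /negbFE.
  by move: cy; rewrite -Exy => /bnd/andP[].
have [i] := low_edge dist_xy bnd; rewrite inE => Di le_i.
have [p' p'in bnd'] := spectrum_bounds (flip x i).
have le_p' : p' <= ecol a (cedge x i).
  suff /bnd'/andP[] : ecol a (cedge x i) \in spectrum a (flip x i) by [].
  by apply/spectrumP; right; exists i; rewrite cedge_flip.
suff /IHk/(_ bnd' cy) : #|[set j | flip x i j != y j]| = k.
  by rewrite big_ord_recr /=; lia.
have := cardsD1 i [set j | x j != y j]; rewrite dist_xy inE Di => -[->].
apply: eq_card => j; rewrite !inE ffunE; case: (eqVneq j i) => [->|_].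
  by move: Di; case: (x i); case: (y i).
by rewrite addbF.
Qed.

End UpperBound.

Lemma coloring_upper_bound t :
  has_interval_total_coloring (hypercube n) t -> t <= 'C(n.+2, 2).
Proof.
case=> t_gt0 [a a_int].
have used c : 1 <= c <= t -> exists x, c \in spectrum a x.
  have [_ _ col _] := a_int; case/col=> [[x <-]|[e /edgesP[x [i ->]] <-]]; exists x.
    by apply/spectrumP; left.
  by apply/spectrumP; right; exists i.
have [x x1] : exists x, 1 \in spectrum a x by apply: used.
have [y yt] : exists y, t \in spectrum a y by apply: used; rewrite t_gt0 leqnn.
have [p _ bnd] := spectrum_bounds a_int x.
have /andP[le_p1 _] := bnd _ x1.
have := spectrum_growth a_int erefl bnd yt.
set k := #|_|; have le_kn : k <= n by rewrite -[leqRHS]card_ord max_card.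
(* The worst case is [k = n], where reversing the index turns the terms into 1, ..., [n]. *)
have : \sum_(j < k) (n - j) <= 'C(n.+1, 2).
  rewrite -triangular_sum [leqRHS](reindex_inj rev_ord_inj) /=.
  rewrite (big_ord_widen _ (fun m => n - m) le_kn) big_mkcond.
  by apply: leq_sum => j _; have := ltn_ord j; case: ifP => //; lia.
rewrite [X in _ -> _ -> _ <= X]binS bin1; lia.
Qed.

(** * Ranks of the colors within a spectrum of the extremal coloring *)

Definition low x := (\sum_(j | x j) j.+1).+1.

Definition digits x (b : bool) := #|[set j | x j == b]|.

Definition digits_above x (b : bool) i := #|[set j | (x j == b) && (i < j)]|.

(** [None] stands for the vertex and [Some i] for its edge in direction [i]; ranks start at 0. Edges
    towards a zero digit are ranked from the top end, hence the subtraction from [n]. *)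
Definition offset x (o : option 'I_n) : nat :=
  if o is Some i then
    if x i then digits_above x true i else n - digits_above x false i
  else digits x true.

Lemma digitsD x : digits x true + digits x false = n.
Proof.
rewrite -[RHS](card_ord n) -(cardsC [set j | x j == true]); congr (_ + _).
by apply: eq_card => j; rewrite !inE; case: (x j).
Qed.

Lemma digits_above_lt x b i : x i = b -> digits_above x b i < digits x b.
Proof.
move=> xi; apply/proper_card/properP; split.
  by apply/subsetP=> k; rewrite !inE => /andP[].
by exists i; rewrite !inE ?xi ?eqxx ?ltnn.
Qed.

Lemma digits_above_decr x b i j :
  x j = b -> i < j -> digits_above x b j < digits_above x b i.
Proof.
move=> xj lt_ij; apply/proper_card/properP; split.
  by apply/subsetP=> k; rewrite !inE => /andP[-> /(ltn_trans lt_ij)].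
by exists j; rewrite !inE ?xj ?eqxx ?lt_ij ?ltnn.
Qed.

Lemma offset_one x i : x i -> offset x (Some i) < digits x true.
Proof. by move=> xi; rewrite /= xi digits_above_lt. Qed.

Lemma offset_zero x i :
  x i = false -> digits x true < offset x (Some i) <= n.
Proof.
move=> xi; rewrite /= xi; have := digitsD x; have := digits_above_lt xi; lia.
Qed.

Lemma offset_le x o : offset x o < n.+1.
Proof.
have le_x := digitsD x; case: o => [i|]; last by rewrite /=; lia.
case xi: (x i); first by have := offset_one xi; lia.
by have := offset_zero xi; lia.
Qed.

(** Directions of one digits have ranks below [digits x true], those of zero digits ranks above it;
    within each block the rank is strictly monotone in the direction. *)
Lemma offset_neq x i j : i < j -> offset x (Some i) <> offset x (Some j).
Proof.
move=> lt_ij; case xi: (x i); case xj: (x j).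
- by rewrite /= xi xj; have := digits_above_decr xj lt_ij; lia.
- by have := offset_one xi; have := offset_zero xj; lia.
- by have := offset_zero xi; have := offset_one xj; lia.
have := offset_zero xi; have := offset_zero xj; rewrite /= xi xj.
by have := digits_above_decr xj lt_ij; lia.
Qed.

Lemma offset_inj x : injective (offset x).
Proof.
have vertex_neq i : offset x (Some i) <> offset x None.
  case xi: (x i); first by have := offset_one xi; rewrite /=; lia.
  by have := offset_zero xi; rewrite /=; lia.
case=> [i|] [j|] // E.
- have [lt_ij|lt_ji|/val_inj-> //] := ltngtP i j.
    by case: (offset_neq lt_ij E).
  by case: (offset_neq lt_ji (esym E)).
- by case: (vertex_neq i).
- by case: (vertex_neq j).
Qed.

Lemma low_flip x i : x i = false -> low (flip x i) = low x + i.+1.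
Proof.
move=> xi; rewrite /low (bigD1 i) /= ?ffunE ?eqxx ?xi // addnC.
rewrite addSn; congr (_ + _).+1; apply: eq_bigl => j; rewrite ffunE.
by case: (eqVneq j i) => [->|_]; rewrite ?xi ?andbF ?addbF ?andbT.
Qed.

Lemma digits_flip x i :
  x i = false -> digits (flip x i) true = (digits x true).+1.
Proof.
move=> xi; rewrite /digits (cardsD1 i) inE ffunE xi eqxx /= add1n; congr _.+1.
apply: eq_card => j; rewrite !inE ffunE.
by case: (eqVneq j i) => [->|_]; rewrite ?xi ?addbF.
Qed.

Lemma digits_above_flip x b i : digits_above (flip x i) b i = digits_above x b i.
Proof.
apply: eq_card => j; rewrite !inE ffunE.
by case: (eqVneq j i) => [->|_]; rewrite ?ltnn ?andbF ?addbF.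
Qed.

Lemma digits_aboveD x i :
  digits_above x true i + digits_above x false i = n - i.+1.
Proof.
have <- : #|[set j : 'I_n | i < j]| = n - i.+1.
  rewrite -sum1_card (eq_bigl (fun j : 'I_n => true && (i < j))) => [|j].
    by rewrite -(big_geq_mkord i.+1 n xpredT (fun=> 1)) sum_nat_const_nat muln1.
  by rewrite inE.
rewrite -(cardsID [set j | x j]); congr (_ + _).
  by apply: eq_card => j; rewrite !inE andbC; case: (x j).
by apply: eq_card => j; rewrite !inE; case: (x j).
Qed.

(** * The extremal coloring and its spectra *)

Definition cube_color x (o : option 'I_n) := low x + offset x o.

(** The two ends of an edge agree on its color: setting digit [i] raises [low] by [i + 1], and the
    rank drops by the same amount because [n - (i + 1)] digits lie above [i]. *)
Lemma cube_color_flip0 x i :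
  x i = false -> cube_color (flip x i) (Some i) = cube_color x (Some i).
Proof.
move=> xi; rewrite /cube_color low_flip //= xi ffunE xi eqxx digits_above_flip /=.
by have := digits_aboveD x i; have := ltn_ord i; lia.
Qed.

Lemma cube_color_flip x i : cube_color (flip x i) (Some i) = cube_color x (Some i).
Proof.
case xi: (x i); last exact: cube_color_flip0.
have xi' : flip x i i = false by rewrite ffunE xi eqxx.
by rewrite -(cube_color_flip0 xi') flipK.
Qed.

(** An edge is read from an arbitrary end; [cube_color_flip] makes the choice harmless. Sets that
    are not edges get the dummy color 0. *)
Definition cube_coloring : coloring (hypercube n) := Coloring
  (fun x : hypercube n => cube_color x None)
  (fun e => if [pick p : hypercube n * 'I_n | e == cedge p.1 p.2] is Some p
            then cube_color p.1 (Some p.2) else 0).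

Lemma ecol_cedge x i : ecol cube_coloring (cedge x i) = cube_color x (Some i).
Proof.
rewrite /=; case: pickP => [[y j] /= /eqP/cedge_eq[<- [->|->]] //|].
  exact: cube_color_flip.
by move/(_ (x, i)); rewrite eqxx.
Qed.

Lemma cube_color_inj x : injective (cube_color x).
Proof. by move=> o o' /addnI/offset_inj. Qed.

Lemma total_cube_coloring : total_coloring cube_coloring.
Proof.
split=> [x y /adjP[i ->]|e f eE fE ef|x e eE /(edge_atP eE)[i ->]].
- wlog xi : x / x i = false.
    move=> wlog_x; case xi: (x i); last exact: wlog_x.
    rewrite -{1}[x](flipK i); apply/nesym/wlog_x.
    by rewrite ffunE xi eqxx.
  (* Setting digit [i] raises the vertex color by [i + 2]: [i + 1] from [low] and 1 from the
     rank. *)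
  by rewrite /= /cube_color low_flip //= digits_flip //; lia.
- case/set0Pn=> x /setIP[/(edge_atP eE)[i Ei] /(edge_atP fE)[j Ej]].
  move: ef; rewrite {}Ei {}Ej !ecol_cedge => /eqP ef /cube_color_inj[ij].
  by rewrite ij in ef.
- by rewrite ecol_cedge => /cube_color_inj.
Qed.

Lemma cube_spectrum x c :
  (c \in spectrum cube_coloring x) = (low x <= c <= low x + n).
Proof.
apply/spectrumP/andP => [H | [le_xc le_cx]].
  have [o ->] : exists o, c = cube_color x o.
    by case: H => [->|[i]]; [exists None | rewrite ecol_cedge; exists (Some i)].
  by rewrite leq_addr leq_add2l -ltnS offset_le.
have card_o : #|{: option 'I_n}| = n.+1 by rewrite card_option card_ord.
(* The [n + 1] distinct ranks below [n + 1] leave no gap. *)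
have [|o Eo] := bounded_injection_onto (@offset_inj x) card_o (offset_le x) (k := c - low x).
  by lia.
have -> : c = cube_color x o by rewrite /cube_color Eo subnKC.
by case: o {Eo} => [i|]; [right; exists i; rewrite ecol_cedge | left].
Qed.

(** * Every color occurs *)

Definition prefix k : hypercube n := [ffun j : 'I_n => j < k].

Lemma low_prefix k : k <= n -> low (prefix k) = 'C(k.+1, 2).+1.
Proof.
move=> le_kn; rewrite -triangular_sum (big_ord_widen n (fun m => m.+1)) //.
by congr _.+1; apply: eq_bigl => j; rewrite ffunE.
Qed.

Lemma low_le x : low x <= 'C(n.+1, 2).+1.
Proof.
by rewrite ltnS -triangular_sum [leqRHS](bigID x) leq_addr.
Qed.

(** From [prefix k] to [prefix k.+1] the lower end moves up by [k + 1 <= n], so consecutive spectra,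
    each of [n + 1] colors, overlap. *)
Lemma prefix_covers k c : k <= n -> 1 <= c <= 'C(k.+1, 2).+1 + n ->
  exists x, low x <= c <= low x + n.
Proof.
elim: k => [|k IHk] le_kn c_bnd; first by exists (prefix 0); rewrite low_prefix.
have [c_small|c_big] := leqP c ('C(k.+1, 2).+1 + n).
  by apply: IHk; [exact: ltnW | case/andP: c_bnd => ->].
exists (prefix k.+1); rewrite low_prefix //.
by move: c_bnd; rewrite [in 'C(k.+2, 2)]binS bin1; lia.
Qed.

Lemma interval_total_cube_coloring :
  interval_total_coloring 'C(n.+2, 2) cube_coloring.
Proof.
(* The last color is the upper end of the spectrum of [prefix n], the all-ones vertex. *)
have tE : 'C(n.+2, 2) = 'C(n.+1, 2).+1 + n by rewrite binS bin1 addSnnS.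
have bnd x c : c \in spectrum cube_coloring x -> 1 <= c <= 'C(n.+2, 2).
  by rewrite cube_spectrum tE; have := low_le x; rewrite /low; lia.
split; [exact: total_cube_coloring | split | |].
- by move=> x; apply: (bnd x); apply/spectrumP; left.
- move=> e /edgesP[x [i ->]]; apply: (bnd x).
  by apply/spectrumP; right; exists i.
- move=> c; rewrite tE => /prefix_covers[//|x]; rewrite -cube_spectrum.
  case/spectrumP=> [->|[i ->]]; [left; exists x | right; exists (cedge x i)] => //.
  exact: cedge_edge.
- by move=> x; exists (low x), (low x + n) => c; exact: cube_spectrum.
Qed.

End Cube.

Theorem theorem12 (n : nat) (hn : 1 <= n) :
  is_Wtau (hypercube n) ((n + 1) * (n + 2) %/ 2).
Proof.
have -> : (n + 1) * (n + 2) %/ 2 = 'C(n.+2, 2).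
  by rewrite bin2 -divn2 addn1 addn2 mulnC.
split; last exact: coloring_upper_bound.
by split; [rewrite bin_gt0 | exists (cube_coloring n); exact: interval_total_cube_coloring].
Qed.
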